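(* Let $n \ge 1$ and let $f:\{0,1\}^n \to \{0,1\}$ be a Boolean function of degree $d$. Then $f$ has at most $4.416 \cdot 2^d$ relevant variables.
   Context: Every function $f:\{0,1\}^n\to\{0,1\}$ agrees on $\{0,1\}^n$ with a unique multilinear polynomial in $\mathbb{R}[x_1,\dots,x_n]$; the degree $\deg(f)$ of $f$ is the degree of this polynomial. A variable $x_i$ is relevant for $f$ if it appears in some monomial with non-zero coefficient in this polynomial (equivalently, there is an input $x$ such that flipping the $i$-th bit of $x$ changes $f(x)$). *)

(* Defs.v *)
From mathcomp Require Import all_boot all_order all_algebra.
Set Implicit Arguments. Unset Strict Implicit. Unset Printing Implicit Defensive.
Import Order.TTheory GRing.Theory Num.Theory.
Local Open Scope ring_scope.

Definition cube (n : nat) := {ffun 'I_n -> bool}.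

Definition mleval (R : numDomainType) (n : nat) (c : {ffun {set 'I_n} -> R})
  (x : cube n) : R :=
  \sum_(S : {set 'I_n}) c S * \prod_(i in S) ((x i)%:R : R).

(* c is the (unique) multilinear polynomial agreeing with f on {0,1}^n. *)
Definition represents (R : numDomainType) (n : nat) (c : {ffun {set 'I_n} -> R})
  (f : cube n -> bool) : Prop :=
  forall x : cube n, mleval c x = (f x)%:R.

(* Degree of a multilinear polynomial: max size of a monomial with
   non-zero coefficient (0 for the zero polynomial). *)
Definition mdeg (R : numDomainType) (n : nat) (c : {ffun {set 'I_n} -> R}) : nat :=
  (\max_(S : {set 'I_n} | c S != 0%R) #|S|)%N.

Definition flip (n : nat) (x : cube n) (i : 'I_n) : cube n :=
  [ffun j => if j == i then ~~ x j else x j].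

Definition relevant_set (n : nat) (f : cube n -> bool) : {set 'I_n} :=
  [set i | [exists x : cube n, f (flip x i) != f x]].

(* Main.v *)
(* For g : {0,1}^n -> R let omega g be 0 if g = 0 and 2^-(deg g) otherwise, and
   for Boolean f let weight f = 1/2 sum_i omega (D_i f), that is, the sum of
   2^-(deg_i f) over the relevant variables, deg_i f being the largest degree of
   a monomial containing x_i.  A function of degree d with r relevant variables
   has r 2^-d <= weight f, so it suffices to bound the weight by 4.416.

   Restricting variables does not decrease the weight of the others on average.
   Hence weight f <= (total influence)/2 <= d/2, and restricting the d variables
   of a monomial of degree d costs at most d 2^-d.  Such a monomial M contains a
   sensitive block at every point, because fixing the variables outside M leaves
   its coefficient unchanged; so each such restriction decreases the block
   sensitivity, until the degree drops.  Block sensitivity thus acts as a budget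
   shared by all degrees: by induction on d,
     weight f <= A_d + d 2^-d bs(f),
   where A_(d+1) combines A_d with weight <= d/2 for d < 8 and with a bound
   bs <= bs_max d on the block sensitivity in degree d for d >= 8.

   The bound bs_max d comes from symmetrizing f over disjoint sensitive blocks: a
   polynomial Q of degree d with Q(0) = 0, Q(1) = 1 and 0 <= Q(t) <= 1 at the
   integers 0 <= t <= N forces N < 2 d^2, and for 8 <= d < 20 a divided
   difference at suitable integer nodes gives about N < 0.59 d^2. *)
Require Import Defs.
From HB Require Import structures.
From Stdlib Require Import ZArith.
From mathcomp Require Import all_boot all_order all_algebra.
From mathcomp Require Import ring lra zify ssrZ.
Set Implicit Arguments. Unset Strict Implicit. Unset Printing Implicit Defensive.
Import Order.TTheory GRing.Theory Num.Theory.
Local Open Scope ring_scope.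

(** * Discrete derivatives and degree *)

Definition upd (n : nat) (x : cube n) (i : 'I_n) (b : bool) : cube n :=
  [ffun j => if j == i then b else x j].

Definition mix (n : nat) (H : {set 'I_n}) (y x : cube n) : cube n :=
  [ffun j => if j \in H then y j else x j].

Lemma updC n (x : cube n) i j b b' : i != j ->
  upd (upd x i b) j b' = upd (upd x j b') i b.
Proof.
move=> ij; apply/ffunP=> k; rewrite !ffunE.
by case: (eqVneq k i) => // ->; rewrite (negbTE ij).
Qed.

Lemma upd_upd n (x : cube n) i b b' : upd (upd x i b) i b' = upd x i b'.
Proof. by apply/ffunP=> k; rewrite !ffunE; case: eqP. Qed.

Lemma upd_id n (x : cube n) i : upd x i (x i) = x.
Proof. by apply/ffunP=> k; rewrite !ffunE; case: eqP => // ->. Qed.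

Lemma upd_mix n (H : {set 'I_n}) (y x : cube n) i b : i \notin H ->
  mix H y (upd x i b) = upd (mix H y x) i b.
Proof.
move=> iH; apply/ffunP=> k; rewrite !ffunE.
by case: (eqVneq k i) => // ->; rewrite (negbTE iH).
Qed.

Lemma mix_upd_in n (H : {set 'I_n}) (y x : cube n) i b : i \in H ->
  mix H y (upd x i b) = mix H y x.
Proof.
move=> iH; apply/ffunP=> k; rewrite !ffunE.
by case: (eqVneq k i) => // ->; rewrite iH.
Qed.

Lemma flipE n (x : cube n) i : flip x i = upd x i (~~ x i).
Proof. by apply/ffunP=> k; rewrite !ffunE; case: eqP => // ->. Qed.

Lemma flipK n (i : 'I_n) : involutive (@flip n ^~ i).
Proof. by move=> x; apply/ffunP=> k; rewrite !ffunE; case: eqP => // _; rewrite negbK. Qed.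

Lemma flip_i n (x : cube n) i : flip x i i = ~~ x i.
Proof. by rewrite ffunE eqxx. Qed.

Section Derivatives.
Variables (R : realFieldType) (n : nat).
Local Notation fn := {ffun cube n -> R}.
Implicit Types (g h : fn) (i j : 'I_n) (s : seq 'I_n) (H S : {set 'I_n}) (k : nat).

(** On the multilinear polynomial of [g] this is the formal partial derivative in [x_i]. *)
Definition pdiff i g : fn := [ffun x => g (upd x i true) - g (upd x i false)].

Fact pdiff_zmod i : zmod_morphism (pdiff i).
Proof. by move=> g h; apply/ffunP=> x; rewrite !ffunE; ring. Qed.
HB.instance Definition _ i := GRing.isZmodMorphism.Build fn fn (pdiff i) (pdiff_zmod i).

Definition restrict H (y : cube n) g : fn := [ffun x => g (mix H y x)].

Fact restrict_zmod H y : zmod_morphism (restrict H y).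
Proof. by move=> g h; apply/ffunP=> x; rewrite !ffunE. Qed.
HB.instance Definition _ H y :=
  GRing.isZmodMorphism.Build fn fn (restrict H y) (restrict_zmod H y).

Lemma pdiff_pdiff i g : pdiff i (pdiff i g) = 0.
Proof. by apply/ffunP=> x; rewrite !ffunE !upd_upd subrr. Qed.

Lemma pdiffC i j g : pdiff i (pdiff j g) = pdiff j (pdiff i g).
Proof.
have [->//|ij] := eqVneq i j; apply/ffunP=> x.
by rewrite !ffunE !(updC x _ _ ij); ring.
Qed.

Lemma pdiff_eq0P i g : reflect (forall x b, g (upd x i b) = g x) (pdiff i g == 0).
Proof.
apply: (iffP eqP) => [g0 x b|gi].
  have /ffunP/(_ x) := g0; rewrite !ffunE => /subr0_eq e.
  rewrite -[in RHS](upd_id x i).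
  by case: b; case: (x i); rewrite ?e.
by apply/ffunP=> x; rewrite !ffunE !gi subrr.
Qed.

Definition pdiffs s g : fn := foldr pdiff g s.

Fact pdiffs_zmod s : zmod_morphism (pdiffs s).
Proof. by move=> g h; elim: s => //= i s ->; rewrite raddfB. Qed.
HB.instance Definition _ s := GRing.isZmodMorphism.Build fn fn (pdiffs s) (pdiffs_zmod s).

Lemma pdiffs_D s i g : pdiffs s (pdiff i g) = pdiff i (pdiffs s g).
Proof. by elim: s => //= j s ->; rewrite pdiffC. Qed.

Lemma pdiffs_cat s t g : pdiffs (s ++ t) g = pdiffs s (pdiffs t g).
Proof. exact: foldr_cat. Qed.

Lemma pdiffs_perm s t g : perm_eq s t -> pdiffs s g = pdiffs t g.
Proof.
elim: s t => [|i s IH] t st; first by have /perm_nilP -> : perm_eq t [::] by rewrite perm_sym.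
have it : i \in t by rewrite -(perm_mem st) mem_head.
case/splitPr: it st => t1 t2 st; rewrite pdiffs_cat /= pdiffs_D -pdiffs_cat; congr (pdiff i _).
apply: IH.
by rewrite -(perm_cons i) (perm_trans st) // -(cat1s i t2) perm_catCA.
Qed.

Lemma pdiffs_in0 s i g : i \in s -> pdiff i g = 0 -> pdiffs s g = 0.
Proof.
move=> si gi; case/splitPr: si => t1 t2.
by rewrite pdiffs_cat /= -pdiffs_D gi !raddf0.
Qed.

Lemma pdiffs_Din s i g : i \in s -> pdiffs s (pdiff i g) = 0.
Proof. by move=> si; apply: (pdiffs_in0 si); rewrite pdiff_pdiff. Qed.

Lemma pdiff_restrict H y i g :
  pdiff i (restrict H y g) = if i \in H then 0 else restrict H y (pdiff i g).
Proof.
apply/ffunP=> x; case: ifP => iH; rewrite !ffunE.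
  by rewrite !mix_upd_in // subrr.
by rewrite !upd_mix ?iH.
Qed.

Lemma pdiffs_restrict H y s g :
  pdiffs s (restrict H y g) = if has (mem H) s then 0 else restrict H y (pdiffs s g).
Proof.
elim: s => //= i s ->; case: ifP => _; first by rewrite orbT raddf0.
by rewrite pdiff_restrict orbF.
Qed.

(* Equivalently, every monomial of the multilinear polynomial of g has at most
   k variables. *)
Definition deg_le g k := forall s, uniq s -> (k < size s)%N -> pdiffs s g = 0.

Lemma deg_le_leq g k l : (k <= l)%N -> deg_le g k -> deg_le g l.
Proof. by move=> kl gk s us ls; apply: gk => //; apply: leq_ltn_trans ls. Qed.

Lemma deg_le_restrict H y g k : deg_le g k -> deg_le (restrict H y g) k.
Proof. by move=> gk s us ks; rewrite pdiffs_restrict gk // raddf0 if_same. Qed.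

Lemma deg_le_D i g k : deg_le g k -> deg_le (pdiff i g) k.-1.
Proof.
move=> gk s us ks; have [si|si] := boolP (i \in s); first exact: pdiffs_Din.
rewrite pdiffs_D; apply: (gk (i :: s)); rewrite /= ?si //.
by move: ks; case: k {gk}.
Qed.

Lemma deg_le0_D i g : deg_le g 0 -> pdiff i g = 0.
Proof. by move=> /(_ [:: i]) /=; apply. Qed.

Lemma pdiffs_enumU i S g : i \notin S ->
  pdiffs (enum (i |: S)) g = pdiff i (pdiffs (enum S) g).
Proof.
move=> iS; rewrite (@pdiffs_perm _ (i :: enum S)) //.
apply: uniq_perm; rewrite ?enum_uniq //= ?mem_enum ?iS ?enum_uniq // => j.
by rewrite inE !mem_enum !inE.
Qed.

(** [pdiffs (enum S) g] is non-zero exactly when some monomial contains [S], so this is the degree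
    of [g], with value [0] at [g = 0]. *)
Definition fdeg g := (\max_(S : {set 'I_n} | pdiffs (enum S) g != 0%R) #|S|)%N.

Lemma fdeg_ge g S : pdiffs (enum S) g != 0 -> (#|S| <= fdeg g)%N.
Proof. by move=> gS; apply: (leq_bigmax_cond (F := fun S : {set 'I_n} => #|S|)). Qed.

Lemma fdeg_deg_le g k : deg_le g k -> (fdeg g <= k)%N.
Proof.
move=> gk; apply/bigmax_leqP=> S; apply: contra_neqT; rewrite -ltnNge => kS.
by apply: gk; rewrite ?enum_uniq // -cardE.
Qed.

Lemma fdeg_ex g : g != 0 -> exists2 S : {set 'I_n}, pdiffs (enum S) g != 0 & #|S| = fdeg g.
Proof.
move=> g0; pose P := [pred S : {set 'I_n} | pdiffs (enum S) g != 0].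
have P0 : (0 < #|P|)%N by apply/card_gt0P; exists set0; rewrite inE enum_set0.
by have [S gS ES] := eq_bigmax_cond (fun S : {set 'I_n} => #|S|) P0; exists S.
Qed.

Definition omega g : R := if g == 0 then 0 else 2^-1 ^+ fdeg g.

Lemma half_ge0 k : 0 <= (2^-1 : R) ^+ k.
Proof. by rewrite exprn_ge0 // invr_ge0 ler0n. Qed.

Lemma half_le k l : (k <= l)%N -> (2^-1 : R) ^+ l <= 2^-1 ^+ k.
Proof. by move=> kl; apply: ler_wiXn2l => //; lra. Qed.

Lemma omega_ge0 g : 0 <= omega g.
Proof. by rewrite /omega; case: ifP => // _; apply: half_ge0. Qed.

Lemma omega0 : omega 0 = 0.
Proof. by rewrite /omega eqxx. Qed.

Lemma omega_deg_le g k : deg_le g k -> g != 0 -> 2^-1 ^+ k <= omega g.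
Proof. by rewrite /omega => /fdeg_deg_le gk /negbTE ->; apply: half_le. Qed.

Lemma omega_le g S : pdiffs (enum S) g != 0 -> omega g <= 2^-1 ^+ #|S|.
Proof.
move=> gS; rewrite /omega; case: ifP => _; first exact: half_ge0.
exact/half_le/fdeg_ge.
Qed.

Definition fix1 i b g : fn := [ffun x => g (upd x i b)].

Lemma fix1_restrict i b g : fix1 i b g = restrict [set i] [ffun=> b] g.
Proof.
apply/ffunP=> x; rewrite !ffunE; congr (g _); apply/ffunP=> j.
by rewrite !ffunE inE.
Qed.

Lemma pdiff_fix1 i b g : pdiff i (fix1 i b g) = 0.
Proof. by rewrite fix1_restrict pdiff_restrict inE eqxx. Qed.

Lemma fdeg_restrict H y g : (fdeg (restrict H y g) <= fdeg g)%N.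
Proof.
apply/bigmax_leqP=> S; rewrite pdiffs_restrict; case: ifP => [_|_ nz]; first by rewrite eqxx.
by apply: fdeg_ge; apply: contra_neq nz => ->; rewrite raddf0.
Qed.

(* If one of the two halves vanishes then g is x_i or 1 - x_i times the other
   half, whose degree is therefore smaller by one. *)
Lemma omega_half i g :
  2 * omega g <= omega (fix1 i true g) + omega (fix1 i false g).
Proof.
have Dg : pdiff i g = fix1 i true g - fix1 i false g.
  by apply/ffunP=> x; rewrite !ffunE.
have drop b : fix1 i b g != 0 -> fix1 i (~~ b) g = 0 ->
    2 * omega g <= omega (fix1 i b g).
  move=> nz z; have [S gS cS] := fdeg_ex nz.
  have iS : i \notin S.
    apply: contraNN gS => iS; apply/eqP.
    by apply: (@pdiffs_in0 _ i); rewrite ?mem_enum ?pdiff_fix1.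
  have gU : pdiffs (enum (i |: S)) g != 0.
    rewrite pdiffs_enumU // -pdiffs_D Dg.
    by case: b nz z gS {cS} => /= _ -> gS; rewrite ?subr0 ?sub0r ?raddfN ?oppr_eq0.
  apply: (@le_trans _ _ (2 * 2^-1 ^+ #|i |: S|)).
    by rewrite ler_pM2l ?ltr0n //; apply: omega_le.
  by rewrite cardsU1 iS /= cS exprS mulVKf ?pnatr_eq0 // /omega (negbTE nz).
have [z1|nz1] := eqVneq (fix1 i true g) 0; have [z0|nz0] := eqVneq (fix1 i false g) 0.
- rewrite z1 z0 omega0 addr0; suff -> : g = 0 by rewrite omega0 mulr0.
  apply/ffunP=> x; rewrite -(upd_id x i).
  case: (x i); [have /ffunP/(_ x) := z1|have /ffunP/(_ x) := z0].
    by rewrite !ffunE.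
  by rewrite !ffunE.
- by rewrite z1 omega0 add0r; apply: drop.
- by rewrite z0 omega0 addr0; apply: drop.
have le b : fix1 i b g != 0 -> omega g <= omega (fix1 i b g).
  move=> nz; have gnz : g != 0.
    by apply: contra_neq nz => ->; apply/ffunP=> x; rewrite !ffunE.
  rewrite /omega (negbTE nz) (negbTE gnz); apply: half_le.
  by rewrite fix1_restrict; apply: fdeg_restrict.
by rewrite mulr_natl mulr2n; apply: lerD; apply: le.
Qed.

Definition mean (F : cube n -> R) : R := (\sum_y F y) / #|{: cube n}|%:R.

Lemma card_cube_gt0 : 0 < (#|{: cube n}|%:R : R).
Proof. by rewrite ltr0n; apply/card_gt0P; exists [ffun=> true]. Qed.

Lemma mean_const c : mean (fun=> c) = c.
Proof.
rewrite /mean sumr_const -[c *+ _]mulr_natr mulfK //.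
exact: lt0r_neq0 card_cube_gt0.
Qed.

Lemma eq_E F G : F =1 G -> mean F = mean G.
Proof. by move=> FG; rewrite /mean (eq_bigr G) // => y _. Qed.

Lemma mean_le F G : (forall y, F y <= G y) -> mean F <= mean G.
Proof.
by move=> FG; rewrite ler_pM2r ?invr_gt0 ?card_cube_gt0 //; apply: ler_sum => y _.
Qed.

Lemma mean_sum (I : Type) (r : seq I) (P : pred I) (F : I -> cube n -> R) :
  \sum_(i <- r | P i) mean (F i) = mean (fun y => \sum_(i <- r | P i) F i y).
Proof. by rewrite /mean exchange_big /= mulr_suml. Qed.

Lemma mean_scale a F : a * mean F = mean (fun y => a * F y).
Proof. by rewrite /mean mulrA mulr_sumr. Qed.

Lemma mean_flip i F : mean (fun y => F (flip y i)) = mean F.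
Proof. by rewrite /mean [in RHS](reindex_inj (inv_inj (flipK i))). Qed.

Lemma mean_add F G : mean F + mean G = mean (fun y => F y + G y).
Proof. by rewrite /mean -mulrDl -big_split. Qed.

Lemma mixU1 i H (y x : cube n) : i \notin H ->
  mix (i |: H) y x = mix H y (upd x i (y i)).
Proof.
move=> iH; apply/ffunP=> j; rewrite !ffunE !inE.
by case: eqVneq => // ->; rewrite (negbTE iH).
Qed.

(** The variables of [H] are fixed one at a time by [omega_half]; pairing [y] with [flip y i] lets
    both values of [x_i] occur equally often. *)
Lemma omega_avg H g : omega g <= mean (fun y => omega (restrict H y g)).
Proof.
rewrite -[H]set_enum; elim: (enum H) (enum_uniq H) => [_|i s IH /= /andP[si us]].
  rewrite (@eq_E _ (fun=> omega g)) ?mean_const // => y; congr omega.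
  by apply/ffunP=> x; rewrite ffunE; congr (g _); apply/ffunP=> j; rewrite ffunE inE.
rewrite set_cons; set K := [set j in s] in IH *; apply: (le_trans (IH us)).
have iK : i \notin K by rewrite inE.
pose F y := omega (restrict (i |: K) y g).
have EF : 2 * mean F = mean (fun y => F y + F (flip y i)).
  by rewrite -mean_add (mean_flip i) mulr_natl mulr2n.
rewrite -(@ler_pM2l _ 2) ?ltr0n // [leRHS]EF mean_scale; apply: mean_le => y.
apply: (le_trans (omega_half i _)).
have R1 b (z : cube n) : z i = b -> (forall j, j != i -> z j = y j) ->
    fix1 i b (restrict K y g) = restrict (i |: K) z g.
  move=> <- zy; apply/ffunP=> x; rewrite !ffunE mixU1 //; congr (g _).
  apply/ffunP=> j; rewrite !ffunE; case: ifP => // jK; rewrite zy //.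
  by apply: contraNneq iK => <-.
case yi : (y i); last rewrite addrC.
  rewrite (R1 true y) // (R1 false (flip y i)) ?flip_i ?yi // => j ji.
  by rewrite ffunE (negbTE ji).
rewrite (R1 false y) // (R1 true (flip y i)) ?flip_i ?yi // => j ji.
by rewrite ffunE (negbTE ji).
Qed.

End Derivatives.

(** * Influence and weight *)

Lemma mixT n (y x : cube n) : mix setT y x = y.
Proof. by apply/ffunP=> i; rewrite ffunE inE. Qed.

Section Influence.
Variables (R : realFieldType) (n : nat).
Local Notation fn := {ffun cube n -> R}.
Implicit Types (g h : fn) (i j : 'I_n) (s : seq 'I_n) (H S M : {set 'I_n}) (k : nat).

Definition sqnorm g : R := \sum_x g x ^+ 2.

(** The parallelogram law on each pair [x], [flip x i]. *)
Lemma sqnorm_split i g :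
  sqnorm (fix1 i true g + fix1 i false g) + sqnorm (pdiff i g) = 4 * sqnorm g.
Proof.
have -> : 4 * sqnorm g = 2 * \sum_x (g x ^+ 2 + g (flip x i) ^+ 2).
  have F : \sum_x g (flip x i) ^+ 2 = sqnorm g.
    by rewrite /sqnorm [RHS](reindex_inj (inv_inj (flipK i))).
  by rewrite big_split /= F /sqnorm; ring.
rewrite /sqnorm -big_split mulr_sumr; apply: eq_bigr => x _.
rewrite !ffunE flipE -{5}(upd_id x i).
by case: (x i) => /=; ring.
Qed.

Lemma pdiff_fix1C i j b g : j != i -> pdiff j (fix1 i b g) = fix1 i b (pdiff j g).
Proof. by move=> ji; rewrite !fix1_restrict pdiff_restrict inE (negbTE ji). Qed.

(* Orthogonal splitting of g along x_i: the sum of the two halves has degree at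
   most k and their difference, pdiff i g, has degree at most k - 1. *)
Lemma influence_le s k g : uniq s ->
    (forall t, uniq t -> {subset t <= s} -> (k < size t)%N -> pdiffs t g = 0) ->
  \sum_(i <- s) sqnorm (pdiff i g) <= 4 * k%:R * sqnorm g.
Proof.
elim: s k g => [|i s IH] k g /=.
  by rewrite big_nil !mulr_ge0 ?ler0n // sumr_ge0 // => x _; rewrite sqr_ge0.
case/andP=> si us gk; rewrite big_cons.
have fixk b t : uniq t -> {subset t <= s} -> (k < size t)%N -> pdiffs t (fix1 i b g) = 0.
  move=> ut ts kt; rewrite fix1_restrict pdiffs_restrict gk ?raddf0 ?if_same //.
  by move=> j /ts js; rewrite inE js orbT.
have IHp := IH k (fix1 i true g + fix1 i false g) us.
have IHm := IH k.-1 (pdiff i g) us.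
have /IHp {}IHp : forall t, uniq t -> {subset t <= s} -> (k < size t)%N ->
    pdiffs t (fix1 i true g + fix1 i false g) = 0.
  by move=> t ut ts kt; rewrite raddfD /= !fixk ?addr0.
have /IHm {}IHm : forall t, uniq t -> {subset t <= s} -> (k.-1 < size t)%N ->
    pdiffs t (pdiff i g) = 0.
  move=> t ut ts kt; rewrite pdiffs_D; apply: (gk (i :: t)) => /=.
  - by rewrite ut andbT; apply: contra si => /ts.
  - by move=> j; rewrite !inE => /predU1P[->|/ts ->]; rewrite ?eqxx ?orbT.
  - by move: kt; case: (k).
(* The lower degree of [pdiff i g] saves [4 * sqnorm (pdiff i g)], which pays for the term of [i]
   itself. For [k = 0], where [k.-1] is no smaller, this derivative vanishes. *)
have k1 : 4 * k.-1%:R * sqnorm (pdiff i g) =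
    4 * k%:R * sqnorm (pdiff i g) - 4 * sqnorm (pdiff i g).
  case: k gk {IHp IHm fixk} => [gk|k _]; last by rewrite /= -[in RHS]natr1; ring.
  have -> : pdiff i g = 0.
    by apply: (gk [:: i]) => // j; rewrite !inE => /eqP ->; rewrite eqxx.
  by rewrite /sqnorm big1 ?mulr0 ?subr0 // => x _; rewrite ffunE expr0n.
have sp := sqnorm_split i g.
have : \sum_(j <- s) sqnorm (pdiff j (fix1 i true g + fix1 i false g)) +
       \sum_(j <- s) sqnorm (pdiff j (pdiff i g)) = 4 * \sum_(j <- s) sqnorm (pdiff j g).
  rewrite -big_split mulr_sumr; apply: eq_big_seq => j js /=.
  have ji : j != i by apply: contraNneq si => <-.
  by rewrite raddfD /= !pdiff_fix1C // pdiffC sqnorm_split.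
move: IHp IHm; rewrite k1.
set a := \sum_(_ <- _) _; set b := \sum_(_ <- _) _; set c := \sum_(_ <- _) _.
move: sp; set p := sqnorm (_ + _); set m := sqnorm (pdiff i g) => sp IHp IHm abc.
have spk : k%:R * (p + m) = k%:R * (4 * sqnorm g) by rewrite sp.
lra.
Qed.

Definition real_fun (f : cube n -> bool) : fn := [ffun x => (f x)%:R].

Definition weight g : R := 2^-1 * \sum_i omega (pdiff i g).

Lemma omega_const c : omega ([ffun=> c] : fn) <= (c != 0)%:R.
Proof.
have [->|c0] := eqVneq c 0; rewrite /omega.
  by rewrite ifT //; apply/eqP/ffunP=> x; rewrite !ffunE.
case: ifP => // _; rewrite -[leRHS](expr0 2^-1).
exact: half_le.
Qed.

Lemma weight_le_deg f k : deg_le (real_fun f) k -> weight (real_fun f) <= k%:R / 2.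
Proof.
move=> fk; rewrite /weight mulrC ler_pM2r ?invr_gt0 ?ltr0n //.
(* The shift makes the square constantly 1/4 and leaves all derivatives alone, so that
   [influence_le] bounds the total influence by [k]. *)
pose h := real_fun f - [ffun=> 2^-1].
have Dh i : pdiff i h = pdiff i (real_fun f).
  by rewrite raddfB /=; apply/ffunP=> x; rewrite !ffunE; ring.
(* Fixing all variables leaves constants in {-1, 0, 1}, whose [omega] is at most their square. *)
have om i : omega (pdiff i (real_fun f)) <= mean (fun y => pdiff i (real_fun f) y ^+ 2).
  apply: (le_trans (omega_avg setT _)); apply: mean_le => y.
  have -> : restrict setT y (pdiff i (real_fun f)) = [ffun=> pdiff i (real_fun f) y].
    by apply/ffunP=> x; rewrite [LHS]ffunE [RHS]ffunE mixT.
  apply: (le_trans (omega_const _)); rewrite !ffunE.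
  by do 2!case: (f _); rewrite /= ?subrr ?subr0 ?sub0r ?oppr_eq0 ?oner_eq0 ?sqrrN
    ?eqxx ?expr1n ?expr0n.
apply: (@le_trans _ _ (\sum_i mean (fun y => pdiff i (real_fun f) y ^+ 2))).
  by apply: ler_sum => i _; apply: om.
rewrite mean_sum.
rewrite /mean exchange_big /= ler_pdivrMr ?card_cube_gt0 //.
have sqh : sqnorm h = #|{: cube n}|%:R / 4.
  rewrite /sqnorm (eq_bigr (fun=> 4^-1)) => [|x _].
    by rewrite sumr_const mulrC mulr_natr.
  by rewrite !ffunE; case: (f x) => /=; field.
have dh t : uniq t -> {subset t <= enum 'I_n} -> (k < size t)%N -> pdiffs t h = 0.
  move=> ut _ kt; suff -> : pdiffs t h = pdiffs t (real_fun f) by exact: fk.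
  by case: t kt {ut} => // i t _ /=; rewrite -!pdiffs_D Dh.
have := influence_le (enum_uniq _) dh; rewrite sqh big_enum /= => inf.
rewrite [leRHS](_ : _ = 4 * k%:R * (#|{: cube n}|%:R / 4)); last by field.
by apply: le_trans inf; apply: ler_sum => i _; rewrite Dh.
Qed.

Definition block_cost k : R := k%:R * 2^-1 ^+ k.

(** For [i] in [M], [pdiff i g] has a monomial containing [M :\ i], so its [omega] is at most
    [2^-(#|M| - 1)]; for the other variables [omega_avg] applies. *)
Lemma weight_restrict g M : pdiffs (enum M) g != 0 ->
  weight g <= block_cost #|M| + mean (fun y => weight (restrict M y g)).
Proof.
move=> gM; have ->: mean (fun y => weight (restrict M y g)) =
    2^-1 * \sum_i mean (fun y => omega (pdiff i (restrict M y g))).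
  by rewrite mean_sum mean_scale.
rewrite /weight (bigID (mem M)) /= mulrDr; apply: lerD.
  apply: (@le_trans _ _ (2^-1 * \sum_(i in M) 2^-1 ^+ #|M|.-1)).
    rewrite ler_pM2l ?invr_gt0 ?ltr0n //; apply: ler_sum => i iM.
    rewrite (_ : #|M|.-1 = #|M :\ i|).
      by apply: omega_le; rewrite pdiffs_D -pdiffs_enumU ?setD1K ?setD11.
    by rewrite (cardsD1 i M) iM.
  rewrite sumr_const -(mulr_natl (_ ^+ _)) mulrCA /block_cost.
  by case: #|M| => [|k]; rewrite ?mul0r // exprS.
rewrite ler_pM2l ?invr_gt0 ?ltr0n // [leRHS](bigID (mem M)) /=.
rewrite -[leLHS]add0r; apply: lerD.
  apply: sumr_ge0 => i _; rewrite -(mean_const n 0); apply: mean_le => y; exact: omega_ge0.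
apply: ler_sum => i iM; apply: (le_trans (omega_avg M _)); apply: mean_le => y.
by rewrite pdiff_restrict (negbTE iM).
Qed.

Lemma D0_const h x y : (forall i, pdiff i h = 0) -> h x = h y.
Proof.
move=> h0; have hs (s : seq 'I_n) : h (mix [set i in s] y x) = h x.
  elim: s => [|i s IH].
    by congr (h _); apply/ffunP=> j; rewrite ffunE inE.
  rewrite -IH -[RHS](pdiff_eq0P _ _ (introT eqP (h0 i)) _ (y i)); congr (h _).
  apply/ffunP=> j; rewrite !ffunE !inE; case: eqVneq => //= ->.
  by [].
by rewrite -(hs (enum 'I_n)); congr (h _); apply/ffunP=> j; rewrite ffunE inE mem_enum.
Qed.

(** A further derivative in a variable outside [M] exceeds the degree, and one in a variable of [M]
    repeats a derivative; both vanish. *)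
Lemma pdiffs_top_const g M x y : deg_le g #|M| -> pdiffs (enum M) g x = pdiffs (enum M) g y.
Proof.
move=> gM; apply: D0_const => i; have [iM|iM] := boolP (i \in M).
  by rewrite -pdiffs_D pdiffs_Din // mem_enum.
rewrite -pdiffs_enumU //; apply: gM; first exact: enum_uniq.
by rewrite -cardE cardsU1 iM.
Qed.

End Influence.

(** * Block sensitivity *)

Definition flips (n : nat) (x : cube n) (P : pred 'I_n) : cube n :=
  [ffun i => x i (+) P i].

(* Disjoint blocks are the fibres p^-1(j), j < b, of a labelling p; indices
   labelled b or more belong to no block. *)
Definition bs_le (n : nat) (f : cube n -> bool) (B : nat) : Prop :=
  forall x (p : 'I_n -> nat) b,
    (forall j, (j < b)%N -> f (flips x (fun i => p i == j)) != f x) -> (b <= B)%N.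

Section BlockSensitivity.
Variables (R : realFieldType) (n : nat).
Implicit Types (g : {ffun cube n -> R}) (f : cube n -> bool) (M : {set 'I_n}).
Local Notation real_fun := (@real_fun R n).

Lemma real_fun_mix f M y : real_fun (fun x => f (mix M y x)) = restrict M y (real_fun f).
Proof. by apply/ffunP=> x; rewrite !ffunE. Qed.

(** Otherwise [f] is constant on the subcube through [x] in which only the variables of [M] vary,
    and a derivative along the non-empty set [M] kills constants. *)
Lemma sensitive_subset f M x : (0 < #|M|)%N -> pdiffs (enum M) (real_fun f) x != 0 ->
  exists2 C : {set 'I_n}, C \subset M & f (flips x (mem C)) != f x.
Proof.
move=> M0 Mx; have [C /andP[CM Cx]|none] :=
  pickP [pred C : {set 'I_n} | (C \subset M) && (f (flips x (mem C)) != f x)].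
  by exists C.
have : restrict (~: M) x (pdiffs (enum M) (real_fun f)) x != 0.
  rewrite ffunE (_ : mix _ _ _ = x) //.
  by apply/ffunP=> i; rewrite ffunE; case: ifP.
have -> : restrict (~: M) x (pdiffs (enum M) (real_fun f)) =
    pdiffs (enum M) (restrict (~: M) x (real_fun f)).
  rewrite pdiffs_restrict ifF //; apply/negP=> /hasP[i].
  by rewrite mem_enum /= inE => ->.
have -> : restrict (~: M) x (real_fun f) = [ffun=> (f x)%:R].
  apply/ffunP=> z; rewrite !ffunE; congr (_%:R); apply/eqP.
  have := none [set i in M | x i != z i] => /=.
  rewrite (_ : _ \subset _) /=; last by apply/subsetP=> i; rewrite inE => /andP[].
  move/negbFE/eqP <-; apply/eqP; congr (nat_of_bool (f _)); apply/ffunP=> i.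
  rewrite !ffunE !inE; case: (i \in M) => /=; last by rewrite addbF.
  by case: (x i); case: (z i).
have [i iM] : exists i, i \in M by apply/card_gt0P.
rewrite (@pdiffs_in0 _ _ _ i) ?mem_enum ?ffunE ?eqxx //.
by apply/ffunP=> z; rewrite !ffunE subrr.
Qed.

(** Blocks of the restricted function can be taken outside [M], so the sensitive block found inside
    [M] is disjoint from them and adds one more. *)
Lemma bs_le_mix f M B y : (0 < #|M|)%N -> deg_le (real_fun f) #|M| ->
    pdiffs (enum M) (real_fun f) != 0 -> bs_le f B ->
  (0 < B)%N /\ bs_le (fun x => f (mix M y x)) B.-1.
Proof.
move=> M0 fM nzM fB.
have nz x : pdiffs (enum M) (real_fun f) x != 0.
  apply: contra_neq nzM => x0; apply/ffunP=> z.
  by rewrite [RHS]ffunE (pdiffs_top_const z x fM) x0.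
have key x (p : 'I_n -> nat) b :
    (forall j, (j < b)%N ->
      f (mix M y (flips x (fun i => p i == j))) != f (mix M y x)) -> (b < B)%N.
  move=> pb; have [C CM Cx] := sensitive_subset M0 (nz (mix M y x)).
  (* The block inside [M] gets the label [b]; [b.+1] marks the indices in no block. *)
  pose q i := if i \in M then (if i \in C then b else b.+1)
              else (if (p i < b)%N then p i else b.+1).
  apply: (fB (mix M y x) q b.+1) => j; rewrite ltnS leq_eqVlt => /predU1P[->|jb].
    rewrite (_ : flips _ _ = flips (mix M y x) (mem C)) //.
    apply/ffunP=> i; rewrite !ffunE /q /=; congr (_ (+) _).
    have := subsetP CM i; case: (i \in M); case: (i \in C) => //.
    - by rewrite eqxx.
    - by move=> _; apply/negbTE; lia.
    - by move=> /(_ isT).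
    - by move=> _; case: ifP => ?; apply/negbTE; lia.
  rewrite (_ : flips _ _ = mix M y (flips x (fun i => p i == j))); first exact: pb.
  apply/ffunP=> i; rewrite !ffunE /q; case: (i \in M).
    by rewrite (_ : (_ == j) = false) ?addbF //; case: ifP => _; apply/negbTE; lia.
  by congr (_ (+) _); case: ifP => // ?; apply/idP/idP; lia.
(* Already for [b = 0] the block inside [M] forces [0 < B]. *)
split; first by apply: leq_ltn_trans (key y (fun=> 0%N) 0%N _).
by move=> x p b /key; case: (B).
Qed.

Definition weight_bound k (A : R) := forall f B, deg_le (real_fun f) k -> bs_le f B ->
  weight (real_fun f) <= A + block_cost R k * B%:R.

Lemma deg_le_pred g k : deg_le g k.+1 ->
    (forall M, (#|M| == k.+1) && (pdiffs (enum M) g != 0) = false) ->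
  deg_le g k.
Proof.
move=> gk none s us; rewrite leq_eqVlt => /predU1P[sk|]; last exact: gk.
have ps : perm_eq s (enum [set i in s]).
  by apply: uniq_perm; rewrite ?enum_uniq // => i; rewrite mem_enum inE.
have := none [set i in s]; rewrite cardE -(perm_size ps) -sk eqxx /=.
by rewrite (pdiffs_perm _ ps) => /negbFE/eqP.
Qed.

(* As long as f has a monomial M of degree k + 1, restricting M costs at most
   block_cost (k + 1) and uses up one unit of block sensitivity. *)
Lemma weight_bound_step k (A : R) :
    (forall f B, deg_le (real_fun f) k -> bs_le f B ->
       weight (real_fun f) <= A + block_cost R k.+1 * B%:R) ->
  weight_bound k.+1 A.
Proof.
move=> Ak f B; elim: B f => [|B IH] f fk fB;
  have [M /andP[/eqP cM nzM]|none] :=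
    pickP [pred M : {set 'I_n} | (#|M| == k.+1) && (pdiffs (enum M) (real_fun f) != 0)];
  try by apply: Ak => //; apply: deg_le_pred fk none.
- have M0 : (0 < #|M|)%N by rewrite cM.
  rewrite -cM in fk.
  by have [] := bs_le_mix [ffun=> true] M0 fk nzM fB.
- have M0 : (0 < #|M|)%N by rewrite cM.
  have fM : deg_le (real_fun f) #|M| by rewrite cM.
  apply: (le_trans (weight_restrict nzM)); rewrite cM.
  apply: (@le_trans _ _
    (block_cost R k.+1 + mean (fun y : cube n => A + block_cost R k.+1 * B%:R))).
    rewrite lerD2l; apply: mean_le => y; rewrite -real_fun_mix; apply: IH.
      by rewrite real_fun_mix; apply: deg_le_restrict.
    by have [] := bs_le_mix y M0 fM nzM fB.
  by rewrite mean_const -natr1; lra.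
Qed.

Lemma block_cost_ge0 k : 0 <= block_cost R k.
Proof. by rewrite mulr_ge0 ?ler0n ?half_ge0. Qed.

Lemma weight_bound1 : weight_bound 1 0.
Proof.
apply: weight_bound_step => f B /weight_le_deg f0 _; apply: (le_trans f0).
by rewrite mul0r add0r mulr_ge0 ?ler0n ?block_cost_ge0.
Qed.

(** The ratio of [block_cost] at [k.+1] and at [k] is [(k + 1) / (2 k) <= 1]. The convex combination
    of the inductive bound, with this ratio as its coefficient, and of [weight <= k / 2] has exactly
    the new cost per unit of block sensitivity. *)
Lemma weight_bound_interp k (A A' : R) : (0 < k)%N ->
    A' = k.+1%:R / (2 * k%:R) * A + (1 - k.+1%:R / (2 * k%:R)) * (k%:R / 2) ->
  weight_bound k A -> weight_bound k.+1 A'.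
Proof.
move=> k0 -> Ak; apply: weight_bound_step => f B fk fB.
have := Ak f B fk fB; have := weight_le_deg fk.
have kp : 0 < k%:R :> R by rewrite ltr0n.
rewrite (_ : block_cost R k.+1 = k.+1%:R / (2 * k%:R) * block_cost R k); last first.
  by rewrite /block_cost exprS; field; rewrite lt0r_neq0.
have t0 : 0 <= k.+1%:R / (2 * k%:R) :> R by rewrite divr_ge0 ?mulr_ge0 ?ler0n.
have t1 : 0 <= 1 - k.+1%:R / (2 * k%:R) :> R.
  rewrite subr_ge0 ler_pdivrMr ?mulr_gt0 ?ltr0n // mul1r -natrM ler_nat; lia.
move: t0 t1; set t := _ / (2 * _) => t0 t1 /(ler_wpM2l t1) w1 /(ler_wpM2l t0) w2.
lra.
Qed.

(** Passing from [block_cost k] to [block_cost k.+1] leaves [(k - 1) / 2^(k + 1)] per unit of block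
    sensitivity to be charged to the constant, for at most [b] units. *)
Lemma weight_bound_budget k (A : R) b : (0 < k)%N ->
    (forall f, deg_le (real_fun f) k -> bs_le f b) ->
  weight_bound k A -> weight_bound k.+1 (A + k.-1%:R * b%:R * 2^-1 ^+ k.+1).
Proof.
move=> k0 kb Ak; apply: weight_bound_step => f B fk fB.
have r1 : bs_le f (minn B b).
  by move=> x p c pc; rewrite leq_min (fB x p) ?(kb f fk x p).
have := Ak f _ fk r1; set r := minn B b.
have rB : r%:R <= B%:R :> R by rewrite ler_nat geq_minl.
have rb : r%:R <= b%:R :> R by rewrite ler_nat geq_minr.
have dl : block_cost R k = block_cost R k.+1 + k.-1%:R * 2^-1 ^+ k.+1.
  by rewrite /block_cost exprS -[in LHS](prednK k0) -[in RHS](prednK k0) -!natr1 /=; field.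
have d0 : 0 <= k.-1%:R * 2^-1 ^+ k.+1 :> R by rewrite mulr_ge0 ?ler0n ?half_ge0.
have := ler_wpM2l (block_cost_ge0 k.+1) rB; have := ler_wpM2l d0 rb; rewrite dl; lra.
Qed.

End BlockSensitivity.

(** * Symmetrization *)

Section Symmetrization.
Variables (R : realFieldType) (N : nat).
Implicit Types (T z : {set 'I_N}) (F G : {set 'I_N} -> R).

(* Linear span of the monomials z |-> (T \subset z) with #|T| <= k. *)
Inductive lowdeg (k : nat) : ({set 'I_N} -> R) -> Prop :=
| lowdeg_zero G : (forall z, G z = 0) -> lowdeg k G
| lowdeg_add a T F G : (#|T| <= k)%N -> lowdeg k F ->
    (forall z, G z = a * (T \subset z)%:R + F z) -> lowdeg k G.

Lemma lowdeg_eq k F G : (forall z, G z = F z) -> lowdeg k F -> lowdeg k G.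
Proof.
move=> GF sF; case: sF GF => [F' F0 GF|a T F' G' Tk sF' FE GF].
  by apply: lowdeg_zero => z; rewrite GF F0.
by apply: (lowdeg_add (a := a) Tk sF') => z; rewrite GF FE.
Qed.

Lemma lowdeg_leq k l G : (k <= l)%N -> lowdeg k G -> lowdeg l G.
Proof.
move=> kl; elim=> [F F0|a T F F' Tk _ IH FE]; first exact: lowdeg_zero.
by apply: (lowdeg_add _ IH FE); apply: leq_trans kl.
Qed.

Lemma lowdegD k F G : lowdeg k F -> lowdeg k G -> lowdeg k (fun z => F z + G z).
Proof.
move=> sF sG; elim: sF => [{}F F0|a T F' {}F Tk _ IH FE].
  by apply: lowdeg_eq sG => z; rewrite F0 add0r.
by apply: (lowdeg_add Tk IH) => z; rewrite FE addrA.
Qed.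

Lemma lowdegZ k b G : lowdeg k G -> lowdeg k (fun z => b * G z).
Proof.
elim=> [F F0|a T F F' Tk _ IH FE]; first by apply: lowdeg_zero => z; rewrite F0 mulr0.
by apply: (lowdeg_add Tk IH (a := b * a)) => z; rewrite FE mulrDr mulrA.
Qed.

Lemma lowdeg_const k c : lowdeg k (fun=> c).
Proof.
apply: (@lowdeg_add _ c set0 (fun=> 0)); first by rewrite cards0.
  exact: lowdeg_zero.
by move=> z; rewrite sub0set mulr1 addr0.
Qed.

Lemma lowdeg_mem k j G : lowdeg k G -> lowdeg k.+1 (fun z => (j \in z)%:R * G z).
Proof.
elim=> [F F0|a T F F' Tk _ IH FE]; first by apply: lowdeg_zero => z; rewrite F0 mulr0.
apply: (@lowdeg_add _ a (j |: T) _ _ _ IH) => [|z].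
  by rewrite cardsU1; case: (j \notin T); rewrite ?ltnS // ltnW.
by rewrite FE subUset sub1set; case: (j \in z); rewrite ?mul1r // !mul0r mulr0 addr0.
Qed.

Definition binp m : {poly R} := (m`!%:R^-1)%:P * \prod_(l < m) ('X - l%:R%:P).

Lemma size_binp m : (size (binp m) <= m.+1)%N.
Proof.
rewrite /binp mul_polyC; apply: (leq_trans (size_scale_leq _ _)).
by rewrite size_prod_XsubC /index_enum unlock -enumT size_enum_ord.
Qed.

Lemma binpE m t : (binp m).[t%:R] = 'C(t, m)%:R.
Proof.
rewrite /binp hornerM hornerC horner_prod.
have -> : \prod_(l < m) ('X - l%:R%:P).[t%:R] = (t ^_ m)%:R :> R.
  elim: m => [|m IH]; first by rewrite big_ord0.
  rewrite big_ord_recr /= IH hornerXsubC ffactnSr natrM.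
  have [mt|tm] := leqP m t; first by rewrite natrB.
  by rewrite ffact_small // !mul0r.
by rewrite -bin_ffact natrM mulrCA mulVf ?mulr1 // pnatr_eq0 -lt0n fact_gt0.
Qed.

(** For [m = #|T|] this is [C(N - m, t - m) / C(N, t) = C(t, m) / C(N, m)] freed of denominators:
    averaged over the sets of size [t], a monomial becomes a polynomial in [t] of degree [m]. *)
Lemma card_superset T t : (t <= N)%N ->
  ('C(N, #|T|) * #|[set z : {set 'I_N} | (#|z| == t) && (T \subset z)]| =
   'C(N, t) * 'C(t, #|T|))%N.
Proof.
move=> tN; have TN : (#|T| <= N)%N by rewrite -[leqRHS]card_ord max_card.
have -> : #|[set z : {set 'I_N} | (#|z| == t) && (T \subset z)]| = 'C(N - #|T|, N - t).
  have -> : (N - #|T|)%N = #|~: T| by rewrite [RHS]cardsCs setCK card_ord.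
  rewrite -cards_draws.
  rewrite -(card_imset _ (@setC_inj _)); apply: eq_card => z.
  rewrite !inE; apply/imsetP/andP=> [[y]|[zT /eqP cz]].
    rewrite inE => /andP[/eqP yt Ty] ->.
    by rewrite setCS Ty cardsCs setCK card_ord yt.
  exists (~: z); rewrite ?setCK // inE cardsCs setCK card_ord cz subKn // eqxx.
  by rewrite -setCS setCK.
have [Tt|tT] := leqP #|T| t; last first.
  by rewrite (bin_small tT) (@bin_small (N - #|T|)) ?muln0 //; lia.
apply/eqP; rewrite -(eqn_pmul2r (m := #|T|`! * (N - t)`! * (t - #|T|)`!));
  last by rewrite !muln_gt0 !fact_gt0.
have e1 := bin_fact TN; have e2 := bin_fact tN; have e3 := bin_fact Tt.
have e4 : ('C(N - #|T|, N - t) * ((N - t)`! * (t - #|T|)`!) = (N - #|T|)`!)%N.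
  rewrite -(bin_fact (_ : N - t <= N - #|T|)%N); last by lia.
  by congr (_ * (_ * _`!))%N; lia.
apply/eqP; transitivity N`!; first by rewrite -e1 -e4; ring.
by rewrite -e2 -e3; ring.
Qed.

(** Minsky-Papert symmetrization: [Q] takes at [t] the average of [G] over the sets of size [t]. *)
Lemma lowdeg_symmetrize k G : lowdeg k G ->
  exists2 Q : {poly R}, (size Q <= k.+1)%N &
    forall t, (t <= N)%N -> 'C(N, t)%:R * Q.[t%:R] = \sum_(z : {set 'I_N} | #|z| == t) G z.
Proof.
elim=> [F F0|a T F F' Tk _ [Q sQ QE] FE].
  exists 0; first by rewrite size_poly0.
  by move=> t _; rewrite horner0 mulr0 big1.
exists ((a / 'C(N, #|T|)%:R)%:P * binp #|T| + Q).
  apply: (leq_trans (size_polyD _ _)); rewrite geq_max sQ andbT mul_polyC.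
  apply: (leq_trans (size_scale_leq _ _)); apply: (leq_trans (size_binp _)).
  by rewrite ltnS.
move=> t tN; rewrite hornerD mulrDr QE // hornerM hornerC binpE.
rewrite [RHS](eq_bigr (fun z => a * (T \subset z)%:R + F z)) => [|z _]; last exact: FE.
rewrite big_split /= -mulr_sumr; congr (_ + _).
have -> : \sum_(z : {set 'I_N} | #|z| == t) (T \subset z)%:R =
    #|[set z : {set 'I_N} | (#|z| == t) && (T \subset z)]|%:R :> R.
  rewrite -sum1_card natr_sum big_mkcond [RHS]big_mkcond; apply: eq_bigr => z _.
  by rewrite inE; case: (_ == _); case: (_ \subset _).
have TN : (0 < 'C(N, #|T|))%N by rewrite bin_gt0 -[leqRHS]card_ord max_card.
apply: (mulfI (x := 'C(N, #|T|)%:R)); first by rewrite pnatr_eq0 -lt0n.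
rewrite [RHS]mulrCA -natrM card_superset // natrM; field.
by rewrite pnatr_eq0 -lt0n.
Qed.

End Symmetrization.

Section Blocks.
Variables (R : realFieldType) (n N : nat) (x : cube n) (p : 'I_n -> nat).
Implicit Types (z : {set 'I_N}) (g : {ffun cube n -> R}).

Definition flip_blocks z : cube n :=
  [ffun i => x i (+) [exists j in z, p i == j :> nat]].

(** The blocks are disjoint, so a coordinate depends affinely on at most one membership
    [j \in z]. *)
Lemma lowdeg_coord i k (G : {set 'I_N} -> R) : lowdeg k G ->
  lowdeg k.+1 (fun z => (flip_blocks z i)%:R * G z).
Proof.
move=> sG; have [pN|Np] := ltnP (p i) N; last first.
  apply: (@lowdeg_eq _ _ _ (fun z => (x i)%:R * G z)); last exact/lowdegZ/lowdeg_leq/sG.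
  move=> z; rewrite ffunE (_ : [exists j in z, _] = false) ?addbF //.
  by apply/exists_inP=> -[j _ /eqP pij]; have := ltn_ord j; lia.
have eE z : [exists j in z, p i == j :> nat] = (Ordinal pN \in z).
  apply/exists_inP/idP=> [[j jz /eqP pij]|pz]; last first.
    by exists (Ordinal pN).
  by rewrite (_ : Ordinal pN = j) //; apply/val_inj.
apply: (@lowdeg_eq _ _ _ (fun z => (x i)%:R * G z +
    (1 - 2 * (x i)%:R) * ((Ordinal pN \in z)%:R * G z))).
  by move=> z; rewrite ffunE eE; case: (x i); case: (_ \in z) => /=; ring.
apply: lowdegD; first exact/lowdegZ/lowdeg_leq/sG.
exact/lowdegZ/lowdeg_mem.
Qed.

Definition restr (s : seq 'I_n) (y : cube n) : cube n :=
  [ffun i => (i \in s) && y i].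

(** Expand [g = g(x_i = 0) + x_i * pdiff i g] one variable at a time: the derivative loses a degree
    and the factor [x_i] restores it. Under [restr s] the variables outside [s] are set to 0. *)
Lemma lowdeg_flip_blocks g k : deg_le g k -> lowdeg k (fun z => g (flip_blocks z)).
Proof.
move=> gk; suff /(_ (enum 'I_n)) sr : forall s, uniq s -> forall g k, deg_le g k ->
    lowdeg k (fun z => g (restr s (flip_blocks z))).
  apply: lowdeg_eq (sr (enum_uniq _) _ _ gk) => z; congr (g _).
  by apply/ffunP=> i; rewrite [RHS]ffunE mem_enum.
elim=> [_|i s IH /= /andP[si us]] {gk}g {}k gk.
  apply: (@lowdeg_eq _ _ _ (fun=> g [ffun=> false])); last exact: lowdeg_const.
  by move=> z; congr (g _); apply/ffunP=> j; rewrite !ffunE.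
have gE z : g (restr (i :: s) (flip_blocks z)) =
    g (restr s (flip_blocks z)) +
    (flip_blocks z i)%:R * pdiff i g (restr s (flip_blocks z)).
  move: (flip_blocks z) => y; rewrite [pdiff i g _]ffunE.
  have -> : restr (i :: s) y = upd (restr s y) i (y i).
    by apply/ffunP=> j; rewrite !ffunE inE; case: eqVneq => // ->.
  have r : upd (restr s y) i false = restr s y.
    by apply/ffunP=> j; rewrite !ffunE; case: eqVneq => // ->; rewrite (negbTE si).
  by case: (y i); rewrite r /=; ring.
apply: (lowdeg_eq gE); apply: lowdegD; first exact: IH.
case: k gk => [|k] gk; last exact/lowdeg_coord/IH/(@deg_le_D _ _ i g k.+1).
by apply: lowdeg_zero => z; rewrite (deg_le0_D _ gk) [X in _ * X]ffunE mulr0.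
Qed.

(** Symmetrize the indicator that flipping the blocks in [z] changes [f]: it is 0 at the empty set
    and 1 at singletons, and averages of it stay in [0, 1]. *)
Lemma sensitive_poly (f : cube n -> bool) k : deg_le (real_fun R f) k ->
    (forall j, (j < N)%N -> f (flips x (fun i => p i == j)) != f x) ->
  exists2 Q : {poly R}, (size Q <= k.+1)%N &
    [/\ Q.[0] = 0, (0 < N)%N -> Q.[1] = 1 &
        forall t, (t <= N)%N -> 0 <= Q.[t%:R] <= 1].
Proof.
move=> fk fp; pose G z : R := (f (flip_blocks z) != f x)%:R.
have sG : lowdeg k G.
  have sf := lowdeg_flip_blocks fk.
  (* Comparison with the fixed bit [f x] is affine in the value of [f]. *)
  apply: (@lowdeg_eq _ _ _ (fun z =>
    (f x)%:R + (1 - 2 * (f x)%:R) * real_fun R f (flip_blocks z))); last first.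
    by apply: lowdegD; [apply: lowdeg_const | apply: lowdegZ].
  by move=> z; rewrite ffunE /G; case: (f x); case: (f _) => /=; ring.
have [Q sQ QE] := lowdeg_symmetrize sG; exists Q => //; split.
- have := QE 0 (leq0n _); rewrite bin0 mul1r => ->.
  apply: big1 => z /eqP/cards0_eq ->; rewrite /G (_ : flip_blocks set0 = x) ?eqxx //.
  apply/ffunP=> i; rewrite ffunE (_ : [exists j in _, _] = false) ?addbF //.
  by apply/exists_inP=> -[j]; rewrite inE.
- move=> N0; have := QE 1 N0; rewrite bin1 => e.
  apply: (mulfI (x := N%:R)); first by rewrite pnatr_eq0 -lt0n.
  rewrite e mulr1 (eq_bigr (fun=> 1)).
    rewrite sumr_const; congr (_ *+ _).
    transitivity #|[set z : {set 'I_N} | #|z| == 1%N]|; last first.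
      by rewrite card_draws card_ord bin1.
    by apply: eq_card => z; rewrite inE.
  move=> z /cards1P[j ->]; rewrite /G (_ : flip_blocks _ = flips x (fun i => p i == j)) ?fp //.
  apply/ffunP=> i; rewrite !ffunE; congr (_ (+) _).
  by apply/exists_inP/idP=> [[l]|pj]; [rewrite inE => /eqP -> | exists j; rewrite ?inE].
- move=> t tN; have C0 : 0 < 'C(N, t)%:R :> R by rewrite ltr0n bin_gt0.
  rewrite -(pmulr_rge0 _ C0) -[_ <= 1](ler_pM2l C0) QE // mulr1; apply/andP; split.
    by apply: sumr_ge0 => z _; rewrite ler0n.
  apply: (@le_trans _ _ (\sum_(z : {set 'I_N} | #|z| == t) 1)).
    by apply: ler_sum => z _; rewrite lern1 leq_b1.
  rewrite sumr_const ler_nat -[in leqRHS](card_ord N) -card_draws.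
  by apply: subset_leq_card; apply/subsetP=> z; rewrite inE.
Qed.

End Blocks.

(** * Polynomials with a jump *)

Section FiniteDifferences.
Variable R : realFieldType.
Implicit Types (r Q : {poly R}) (d m : nat).

Lemma size_diff_poly r m : (size r <= m.+1)%N -> (size (r - (r \Po ('X + 1%:P)))%R <= m)%N.
Proof.
set q := 'X + 1%:P; have sq : size q = 2%N by rewrite size_XaddC.
have lq : lead_coef q = 1.
  by rewrite lead_coefDl ?lead_coefX // size_polyX size_polyC oner_eq0.
move=> rm; apply/leq_sizeP=> j mj; rewrite coefB.
have [sj|js] := leqP (size r) j.
  by rewrite !nth_default ?subrr // size_comp_poly2.
have Ej : j = (size r).-1 by lia.
have := @lead_coef_comp _ r q; rewrite sq => /(_ isT).
by rewrite lq expr1n mulr1 !lead_coefE size_comp_poly2 // -Ej => ->; rewrite subrr.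
Qed.

Lemma finite_difference m r c : (size r <= m)%N ->
  \sum_(k < m.+1) (-1) ^+ k * 'C(m, k)%:R * r.[k%:R + c] = 0.
Proof.
elim: m r => [|m IH] r rm.
  by rewrite big_ord_recl big_ord0 (size_poly_leq0P _ rm) horner0 mulr0 addr0.
have := IH _ (size_diff_poly rm).
under eq_bigr => k _ do rewrite hornerD hornerN horner_comp hornerD hornerX hornerC mulrBr.
rewrite sumrB => /subr0_eq e.
rewrite big_ord_recl.
under eq_bigr => k _ do rewrite /bump /= binS natrD mulrDr mulrDl.
rewrite big_split /= addrA.
have -> : \sum_(i < m.+1) (-1) ^+ (1 + i) * 'C(m, i)%:R * r.[(1 + i)%:R + c] =
    - \sum_(i < m.+1) (-1) ^+ i * 'C(m, i)%:R * r.[i%:R + c + 1].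
  rewrite -sumrN; apply: eq_bigr => i _.
  by rewrite exprS natrD (_ : 1 + i%:R + c = i%:R + c + 1); ring.
rewrite -e; apply/eqP; rewrite subr_eq0; apply/eqP.
rewrite [RHS]big_ord_recl big_ord_recr /= (@bin_small m m.+1) //.
by rewrite !bin0 mulr0 mul0r addr0.
Qed.

Lemma bin_central d j : ('C(d.*2, d + j) <= 'C(d.*2, d))%N.
Proof.
elim: j => [|j IH]; first by rewrite addn0.
apply: leq_trans IH; rewrite -(@leq_pmul2l (d + j).+1) // addnS mul_bin_left.
by rewrite leq_mul2r; apply/orP; right; lia.
Qed.

(** With [h = d./2], the sharper bound [1 - 1 / (2 h + 1)] is inductive: the term at [j = 2 (h + 1)]
    is at most [1 / (2 h + 1) - 1 / (2 h + 3)]. *)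
Lemma central_sum_lt1 d :
  \sum_(1 <= j < d.+1) (~~ odd j)%:R * (2 / (2 * j%:R ^+ 2 - 1)) < 1 :> R.
Proof.
suff : \sum_(1 <= j < d.+1) (~~ odd j)%:R * (2 / (2 * j%:R ^+ 2 - 1)) <=
    1 - (2 * (d./2)%:R + 1)^-1 :> R.
  move/le_lt_trans; apply; rewrite gtrBl invr_gt0.
  by rewrite ltr_wpDl ?mulr_ge0 ?ler0n // ltr01.
elim: d => [|d IH]; first by rewrite big_geq //= mulr0 add0r invr1 subrr.
rewrite big_nat_recr //= uphalf_half.
have [od|ed] := boolP (odd d); last by rewrite mul0r addr0 add0n.
rewrite /= mul1r.
have -> : d.+1%:R = 2 * (1 + (d./2)%:R) :> R.
  have -> : d.+1 = (2 * (1 + d./2))%N by have := odd_double_half d; rewrite od; lia.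
  by rewrite natrM natrD.
apply: (le_trans (lerD IH (lexx _))).
rewrite natrD /=; set h := (d./2)%:R; have h0 : 0 <= h :> R by rewrite ler0n.
have a0 : 0 < 2 * h + 1 :> R by lra.
have b0 : 0 < 2 * (1 + h) + 1 :> R by lra.
have c0 : 0 < 2 * (2 * (1 + h)) ^+ 2 - 1 :> R by nra.
rewrite -subr_ge0 (_ : _ - _ =
    2 * ((2 * (2 * (1 + h)) ^+ 2 - 1) - (2 * h + 1) * (2 * (1 + h) + 1)) /
    ((2 * h + 1) * (2 * (1 + h) + 1) * (2 * (2 * (1 + h)) ^+ 2 - 1))).
  apply: divr_ge0; first nra.
  by rewrite !mulr_ge0 // ltW.
by field; apply/and3P; split; apply: lt0r_neq0; rewrite -/h; nra.
Qed.

(* With S = (Q - Q(1)) / (X - 1), the polynomial S(2 X^2) has degree less than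
   2 d, so its central difference of order 2 d vanishes.  The middle term is
   'C(2 d, d), and the terms +-j can only cancel it for even j, by at most
   'C(2 d, d) * 2 / (2 j^2 - 1) in total. *)
Lemma jump_lt_quadratic d N Q : (0 < d)%N -> (size Q <= d.+1)%N ->
    Q.[0] = 0 -> Q.[1] = 1 -> (forall t, (t <= N)%N -> 0 <= Q.[t%:R] <= 1) ->
  (N < 2 * d ^ 2)%N.
Proof.
move=> d0 sQ Q0 Q1 Q01; rewrite ltnNge; apply/negP=> dN.
have [S PE] : exists S, Q - 1%:P = S * ('X - 1%:P).
  by apply/factor_theorem/rootP; rewrite hornerD hornerN hornerC Q1 subrr.
have SE u : (u - 1) * S.[u] = Q.[u] - 1.
  have := congr1 (horner^~ u) PE.
  by rewrite hornerM hornerXsubC hornerD hornerN hornerC mulrC => ->.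
have S0 : S.[0] = 1 by have := SE 0; rewrite Q0; lra.
have sS : (size S <= d)%N.
  have nzS : S != 0 by apply: contra_eq_neq S0 => ->; rewrite horner0 eq_sym oner_eq0.
  have : (size (Q - 1%:P)%R <= d.+1)%N.
    rewrite (leq_trans (size_polyD _ _)) // geq_max sQ size_polyN size_polyC.
    by rewrite oner_eq0.
  by rewrite PE size_Mmonic ?monicXsubC // size_XsubC addn2.
(* [2 u^2] maps the integers up to [d] to integers up to [2 d^2 <= N], where [Q] takes values in
   [0, 1]. *)
pose q : {poly R} := 2%:P * 'X^2; pose r := S \Po q.
have rE u : r.[u] = S.[2 * u ^+ 2].
  by rewrite horner_comp hornerM hornerC hornerXn.
have sr : (size r <= d.*2)%N.
  apply: (leq_trans (size_comp_poly_leq _ _)).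
  have : (size q <= 3)%N.
    by rewrite /q mul_polyC (leq_trans (size_scale_leq _ _)) // size_polyXn.
  by move: sS; move: (size S) => m; case: (size q) => [|[|[|[|//]]]] md _ /=; lia.
have := finite_difference (- d%:R) sr.
pose F k : R := (-1) ^+ k * 'C(d.*2, k)%:R * r.[k%:R - d%:R].
rewrite (_ : \sum_(k < _) _ = \sum_(0 <= k < d.*2.+1) F k); last by rewrite big_mkord.
(* Split off the middle term [k = d] and pair the terms [d - j] and [d + j]. *)
rewrite (big_cat_nat (n := d)) //=; last by lia.
rewrite [X in _ + X]big_ltn; last by lia.
rewrite -[X in index_iota X d.*2.+1]add1n big_addn (_ : d.*2.+1 - d = d.+1)%N; last by lia.
rewrite big_nat_rev /= -(big_add1 _ _ 0 d.+1 xpredT (fun j => F (d - j)%N)) /=.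
move/(congr1 ( *%R ((-1) ^+ d))); rewrite mulr0 addrCA -big_split /= mulrDr.
have sgn k : (-1) ^+ d * F k = (-1) ^+ (d + k) * 'C(d.*2, k)%:R * r.[k%:R - d%:R].
  by rewrite /F !mulrA -exprD.
rewrite sgn -signr_odd addnn odd_double subrr rE expr0 mul1r expr0n mulr0 S0 mulr1.
set C := 'C(_, _)%:R; have C0 : 0 < C by rewrite ltr0n bin_gt0; lia.
rewrite mulr_sumr => e.
have : - \sum_(1 <= j < d.+1) C * ((~~ odd j)%:R * (2 / (2 * j%:R ^+ 2 - 1))) <=
    \sum_(1 <= i < d.+1) (-1) ^+ d * (F (d - i)%N + F (i + d)%N).
  rewrite -sumrN; apply: ler_sum_nat => j /andP[j1 jd].
  rewrite mulrDr !sgn natrB // natrD.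
  rewrite -[(-1) ^+ (d + (d - j))]signr_odd -[(-1) ^+ (d + (j + d))]signr_odd.
  rewrite (_ : odd (d + (d - j)) = odd j); last by lia.
  rewrite (_ : odd (d + (j + d)) = odd j); last by lia.
  rewrite (_ : d%:R - j%:R - d%:R = - j%:R :> R); last by ring.
  rewrite (_ : j%:R + d%:R - d%:R = j%:R :> R); last by ring.
  rewrite -bin_sub; last by lia.
  rewrite (_ : d.*2 - (d - j) = j + d)%N; last by lia.
  rewrite !rE sqrrN; set u := 2 * j%:R ^+ 2.
  have u1 : 0 < u - 1.
    have : 1 <= j%:R :> R by rewrite ler1n.
    by rewrite /u; nra.
  have uE : u = (2 * j ^ 2)%:R by rewrite natrM natrX.
  have /andP[q0 q1] : 0 <= Q.[u] <= 1.
    by rewrite uE Q01 //; apply: leq_trans dN; rewrite leq_mul2l leq_sqr; lia.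
  (* So [S.[u]] lies between [- 1 / (u - 1)] and [0], and the terms with odd [j] have the sign of
     the middle one. *)
  have -> : S.[u] = - ((1 - Q.[u]) / (u - 1)).
    by apply: (mulfI (lt0r_neq0 u1)); rewrite SE; field; apply: lt0r_neq0.
  have b0 : 0 <= 'C(d.*2, j + d)%:R :> R by rewrite ler0n.
  have bC : 'C(d.*2, j + d)%:R <= C by rewrite ler_nat addnC bin_central.
  set b := 'C(_, _)%:R in b0 bC *.
  have i0 : 0 <= (u - 1)^-1 by rewrite invr_ge0 ltW.
  have x0 : 0 <= (1 - Q.[u]) / (u - 1) by rewrite mulr_ge0 // subr_ge0.
  have x1 : (1 - Q.[u]) / (u - 1) <= (u - 1)^-1.
    by rewrite -[leRHS]mul1r ler_wpM2r // gerBl.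
  move: x0 x1 i0; set i := (u - 1)^-1; set x := (1 - Q.[u]) * i => x0 x1 i0.
  case: (odd j) => /=; rewrite ?expr1 ?expr0; first nra.
  have : b * x <= C * i by apply: ler_pM.
  nra.
have := central_sum_lt1 d; rewrite -(ltr_pM2l C0) mulr1 mulr_sumr; lra.
Qed.

End FiniteDifferences.

(** * Certificates and constants *)

(* Nodes t_2 < ... < t_(d+1) for d = 8, ..., 19, found by a local search around
   the Chebyshev points N sin^2(pi (k - 1) / (2 d)) with N = t_(d+1). *)
Definition jump_nodes : seq (seq nat) := [::
  [:: 2; 6; 12; 20; 27; 33; 37; 39];
  [:: 2; 6; 12; 20; 28; 36; 42; 46; 48];
  [:: 2; 6; 12; 20; 30; 39; 47; 53; 57; 59];
  [:: 2; 6; 12; 21; 31; 41; 51; 60; 66; 70; 72];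
  [:: 2; 6; 13; 21; 32; 42; 53; 64; 72; 79; 83; 85];
  [:: 2; 6; 13; 22; 32; 44; 56; 68; 78; 87; 94; 98; 100];
  [:: 2; 6; 13; 22; 33; 45; 58; 70; 82; 93; 102; 109; 113; 115];
  [:: 2; 6; 13; 22; 33; 46; 59; 73; 86; 99; 110; 119; 126; 130; 132];
  [:: 2; 6; 13; 22; 33; 46; 60; 75; 90; 104; 117; 128; 137; 144; 148; 150];
  [:: 2; 6; 13; 22; 34; 47; 61; 77; 92; 108; 122; 135; 147; 156; 163; 167; 169];
  [:: 2; 6; 13; 22; 34; 48; 63; 79; 95; 111; 127; 142; 156; 168; 177; 184; 188; 190];
  [:: 2; 6; 13; 22; 34; 48; 63; 80; 97; 114; 131; 148; 163; 177; 189; 198; 205; 209; 211]].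

(** Denominators of the divided-difference coefficients. The node 0 contributes a factor but no
    entry, since the polynomials of interest vanish there. *)
Definition node_prods (ts : seq Z) : seq Z :=
  [seq foldr (fun s a => if Z.eqb s t then a else Z.mul (Z.sub t s) a) Z.one
         [:: Z0, Z.one & ts] | t <- Z.one :: ts].

(* Coefficients at 1, t_2, t_3, ... of the divided difference over the nodes
   0, 1, t_2, ..., scaled to integers with a positive coefficient at 1. *)
Definition divided_difference (ts : seq Z) : seq Z :=
  let ps := node_prods ts in
  let L := foldr Z.lcm Z.one ps in
  [seq Z.div (Z.mul (Z.sgn (head Z.one ps)) L) q | q <- ps].

Definition Zsum (l : seq (Z * Z)) : Z := foldr (fun q a => Z.add q.2 a) Z0 l.

(* Moments 1, ..., d only: moment 0 would involve the node 0, where the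
   polynomials of interest vanish. *)
Fixpoint moments_vanish (d : nat) (l : seq (Z * Z)) : bool :=
  if d is d'.+1 then
    let l' := [seq (q.1, Z.mul q.1 q.2) | q <- l] in
    Z.eqb (Zsum l') Z0 && moments_vanish d' l'
  else true.

(* The last condition says that the weight w at 1 exceeds the total absolute
   value of the negative weights, so that no Q with Q(1) = 1 and values in
   [0, 1] at the nodes is annihilated. *)
Definition jump_certificate (d : nat) (ns : seq nat) : bool :=
  all (fun t => t <= last 0%N ns)%N ns &&
  if divided_difference (map Z.of_nat ns) is w :: ws then
    moments_vanish d ((Z.one, w) :: zip (map Z.of_nat ns) ws) &&
    Z.ltb Z0 (foldr (fun q a => Z.add (Z.min Z0 q.2) a) w
                    (zip (map Z.of_nat ns) ws))
  else false.

(** The moments of the actual integer weights are computed, so the formula for divided differences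
    needs no proof. *)
Lemma jump_nodes_certified :
  all (fun d => jump_certificate (8 + d) (nth [::] jump_nodes d)) (iota 0 12).
Proof. by vm_compute. Qed.

Section Certificates.
Variable R : realFieldType.
Implicit Types (Q : {poly R}) (l : seq (Z * Z)).

Definition ZR (z : Z) : R := (int_of_Z z)%:~R.

Lemma ZRD a b : ZR (Z.add a b) = ZR a + ZR b.
Proof. by rewrite /ZR -intrD; congr (_%:~R); lia. Qed.

Lemma ZRM a b : ZR (Z.mul a b) = ZR a * ZR b.
Proof. by rewrite /ZR -intrM; congr (_%:~R); lia. Qed.

Lemma ZR_nat k : ZR (Z.of_nat k) = k%:R.
Proof. by rewrite /ZR pmulrn; congr (_%:~R); lia. Qed.

Lemma ZR_lt a b : Z.lt a b -> ZR a < ZR b.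
Proof. by move=> ab; rewrite /ZR ltr_int; lia. Qed.

Lemma ZR_sum l : ZR (Zsum l) = \sum_(q <- l) ZR q.2.
Proof.
elim: l => [|q l IH]; first by rewrite big_nil.
by rewrite big_cons -IH /= ZRD.
Qed.

Lemma moments_vanishP d l m : moments_vanish d l -> (m < d)%N ->
  \sum_(q <- l) ZR q.2 * ZR q.1 ^+ m.+1 = 0.
Proof.
elim: d l m => // d IH l m /= /andP[/Z.eqb_spec/(congr1 ZR) e lv].
case: m => [_|m]; last first.
  rewrite ltnS => /(IH _ _ lv) e'; rewrite -[RHS]e' big_map; apply: eq_bigr => q _ /=.
  by rewrite ZRM [in LHS]exprS mulrA [_ * ZR q.1]mulrC.
move: e; rewrite ZR_sum big_map => /= e.
transitivity (\sum_(q <- l) ZR (Z.mul q.1 q.2)); last exact: e.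
by apply: eq_bigr => q _; rewrite ZRM expr1 mulrC.
Qed.

Lemma moments_horner d l Q : moments_vanish d l -> (size Q <= d.+1)%N -> Q.[0] = 0 ->
  \sum_(q <- l) ZR q.2 * Q.[ZR q.1] = 0.
Proof.
move=> lv sQ; rewrite horner_coef0 => Q0.
under eq_bigr => q _ do rewrite (horner_coef_wide _ sQ) mulr_sumr.
rewrite exchange_big /= big1 // => i _.
under eq_bigr => q _ do rewrite mulrCA.
rewrite -mulr_sumr; case: i => [[|i] /= id]; first by rewrite Q0 mul0r.
by rewrite (moments_vanishP lv) ?mulr0.
Qed.

Lemma jump_lt_last d ns N Q : jump_certificate d ns -> (size Q <= d.+1)%N ->
    Q.[0] = 0 -> Q.[1] = 1 -> (forall t, (t <= N)%N -> 0 <= Q.[t%:R] <= 1) ->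
  (N < last 0 ns)%N.
Proof.
rewrite /jump_certificate; move: (divided_difference _) => [|w ws].
  by rewrite andbF.
move=> /andP[nsN] /andP[lv /Z.ltb_lt/ZR_lt pos].
move=> sQ Q0 Q1 Q01; rewrite ltnNge; apply/negP=> lN.
have := moments_horner lv sQ Q0; rewrite big_cons /= Q1 mulr1 => e.
(* As [Q] lies in [0, 1] at the nodes, a term of weight [v] is at least [min(0, v)]. *)
have : ZR (foldr (fun q a => Z.add (Z.min Z0 q.2) a) w (zip (map Z.of_nat ns) ws)) <=
    ZR w + \sum_(q <- zip (map Z.of_nat ns) ws) ZR q.2 * Q.[ZR q.1].
  move: nsN lN; move: (last _ _) => L nsL LN {lv pos e}.
  elim: ns ws nsL => [|t ns IH] [|v ws] /=; rewrite ?big_nil ?addr0 //.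
  case/andP=> tL /(IH ws) {}IH; rewrite big_cons /= ZRD addrCA; apply: lerD => //.
  have /andP[q0 q1] := Q01 t (leq_trans tL LN); rewrite ZR_nat.
  have [v0|v0] := Z.leb_spec Z0 v.
    rewrite Z.min_l // mulr_ge0 // -[0]/(ZR Z0) /ZR ler_int; lia.
  rewrite Z.min_r; last by lia.
  have := ZR_lt v0; rewrite -[ZR Z0]/(0 : R); nra.
move: pos; rewrite e -[ZR Z0]/(0 : R); lra.
Qed.

(* For k < 8 the value is meaningless: it is the one for k = 8. *)
Definition bs_max (k : nat) : nat :=
  if (k < 20)%N then (last 0 (nth [::] jump_nodes (k - 8))).-1 else (2 * k ^ 2)%N.

Lemma bs_le_bs_max n (f : cube n -> bool) k : (8 <= k)%N -> deg_le (real_fun R f) k ->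
  bs_le f (bs_max k).
Proof.
move=> k8 fk x p b pb.
have [->|] := posnP b; first by [].
move=> b0; have [Q sQ [Q0 /(_ b0) Q1 Q01]] := sensitive_poly fk pb.
rewrite /bs_max; case: ltnP => k20; last first.
  by apply: ltnW; apply: jump_lt_quadratic sQ Q0 Q1 Q01; lia.
have := allP jump_nodes_certified (k - 8)%N; rewrite mem_iota subnKC // => cert.
have {cert} : (b < last 0 (nth [::] jump_nodes (k - 8)))%N.
  by apply: jump_lt_last sQ Q0 Q1 Q01; apply: cert; lia.
by case: last.
Qed.

(* 292 / 105 is reached from 0 at k = 1 by seven steps of weight_bound_interp. *)
Definition weight_const (k : nat) : R :=
  292 / 105 + \sum_(8 <= i < k) i.-1%:R * (bs_max i)%:R * 2^-1 ^+ i.+1.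

Lemma weight_bound_const n k : (8 <= k)%N -> weight_bound n k (weight_const k).
Proof.
move=> /subnK <-; elim: (k - 8)%N => [|m IH].
  rewrite add0n /weight_const big_geq // addr0.
  have b1 : weight_bound n 1 (0 : R) by exact: weight_bound1.
  have b2 : weight_bound n 2 (0 : R).
    by apply: (weight_bound_interp _ _ b1) => //; field.
  have b3 : weight_bound n 3 (1 / 4 : R).
    by apply: (weight_bound_interp _ _ b2) => //; field.
  have b4 : weight_bound n 4 (2 / 3 : R).
    by apply: (weight_bound_interp _ _ b3) => //; field.
  have b5 : weight_bound n 5 (7 / 6 : R).
    by apply: (weight_bound_interp _ _ b4) => //; field.
  have b6 : weight_bound n 6 (17 / 10 : R).
    by apply: (weight_bound_interp _ _ b5) => //; field.
  have b7 : weight_bound n 7 (269 / 120 : R).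
    by apply: (weight_bound_interp _ _ b6) => //; field.
  by apply: (weight_bound_interp _ _ b7) => //; field.
rewrite addSn /weight_const big_nat_recr ?leq_addl //= addrA.
apply: weight_bound_budget => // [|f fk]; first by rewrite addn_gt0 orbT.
by apply: bs_le_bs_max => //; rewrite leq_addl.
Qed.

Lemma weight_const_le k : (20 <= k)%N ->
  weight_const k + block_cost R k * (bs_max k)%:R <= 4416 / 1000.
Proof.
move=> k20; have -> : bs_max k = (2 * k ^ 2)%N by rewrite /bs_max ltnNge k20.
(* g solves 2 g(x) - g(x + 1) = 2 x^2 (x - 1), which makes the tail telescope. *)
pose g (x : R) := 2 * x ^+ 3 + 4 * x ^+ 2 + 14 * x + 20.
have tail : \sum_(20 <= i < k) i.-1%:R * (bs_max i)%:R * 2^-1 ^+ i.+1 =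
    g 20 * 2^-1 ^+ 20 - g k%:R * 2^-1 ^+ k.
  rewrite -(subnK k20); elim: (k - 20)%N => [|m IH]; first by rewrite big_geq // subrr.
  rewrite addSn big_nat_recr ?leq_addl //= IH.
  rewrite {1}/bs_max ltnNge leq_addl /=; set j := (m + 20)%N.
  have j1 : j.-1%:R = j%:R - 1 :> R by rewrite -subn1 natrB // addn_gt0 orbT.
  by rewrite j1 natrM natrX !(exprS _ j) -[j.+1%:R]natr1 /g; field.
rewrite /weight_const (big_cat_nat (n := 20)) //= tail.
(* The factors 38, 47, ..., 210 are the last nodes of [jump_nodes] minus one. *)
have -> : \sum_(8 <= i < 20) i.-1%:R * (bs_max i)%:R * 2^-1 ^+ i.+1 =
    7 * 38 * 2^-1 ^+ 9 + 8 * 47 * 2^-1 ^+ 10 + 9 * 58 * 2^-1 ^+ 11 +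
    10 * 71 * 2^-1 ^+ 12 + 11 * 84 * 2^-1 ^+ 13 + 12 * 99 * 2^-1 ^+ 14 +
    13 * 114 * 2^-1 ^+ 15 + 14 * 131 * 2^-1 ^+ 16 + 15 * 149 * 2^-1 ^+ 17 +
    16 * 168 * 2^-1 ^+ 18 + 17 * 189 * 2^-1 ^+ 19 + 18 * 210 * 2^-1 ^+ 20 :> R.
  by do 12!rewrite big_ltn //; rewrite big_geq // addr0 !addrA.
have h0 := half_ge0 R k; rewrite /block_cost natrM natrX.
have x0 : 0 <= k%:R :> R by rewrite ler0n.
(* The remainder of the telescoped tail absorbs the term with [block_cost], so the bound does not
   depend on [k]. *)
have : k%:R * 2^-1 ^+ k * (2 * k%:R ^+ 2) <= g k%:R * 2^-1 ^+ k.
  rewrite (_ : _ * _ * _ = (2 * k%:R ^+ 3) * 2^-1 ^+ k); last by ring.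
  by rewrite ler_wpM2r // /g; nra.
rewrite /g; lra.
Qed.

End Certificates.

(** * From the weight to the number of relevant variables *)

Section Juntas.
Variables (R : realFieldType) (n : nat).
Implicit Types (f : cube n -> bool) (c : {ffun {set 'I_n} -> R}).

(** A monomial with non-zero coefficient has fewer variables than [s], hence misses one of them, and
    the derivative in that variable kills it. *)
Lemma represents_deg_le f c : represents c f -> deg_le (real_fun R f) (mdeg c).
Proof.
move=> cf s us sc.
pose mono (S : {set 'I_n}) : {ffun cube n -> R} :=
  [ffun x : cube n => c S * \prod_(i in S) (x i)%:R].
have -> : real_fun R f = \sum_S mono S.
  apply/ffunP=> x; rewrite ffunE -(cf x) sum_ffunE.
  by apply: eq_bigr => S _; rewrite ffunE.
rewrite raddf_sum big1 // => S _.
have [cS|cS] := eqVneq (c S) 0.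
  rewrite (_ : mono S = 0) ?raddf0 //.
  by apply/ffunP=> x; rewrite !ffunE cS mul0r.
have /allPn[i si iS] : ~~ all (mem S) s.
  apply/negP=> /allP sS; move: sc; rewrite ltnNge => /negP; apply.
  have Sc : (#|S| <= mdeg c)%N by apply: (leq_bigmax_cond (F := fun S : {set 'I_n} => #|S|)).
  apply: leq_trans Sc; rewrite cardE; apply: uniq_leq_size => // j /sS.
  by rewrite mem_enum.
apply: (pdiffs_in0 si); apply/ffunP=> x; rewrite !ffunE.
rewrite (eq_bigr (fun j => (upd x i false j)%:R : R)) ?subrr // => j jS.
by rewrite !ffunE; case: eqVneq => // ji; case/negP: iS; rewrite -ji.
Qed.

(** For relevant [i] the derivative is non-zero of degree at most [k - 1]; the factor 1/2 in
    [weight] makes up for the lost degree. *)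
Lemma card_relevant_le_weight f k : deg_le (real_fun R f) k ->
  #|relevant_set f|%:R * 2^-1 ^+ k <= weight (real_fun R f).
Proof.
move=> fk; rewrite /weight [in leRHS](bigID (mem (relevant_set f))) /= [leRHS]mulrDr.
rewrite -[leLHS]addr0; apply: lerD; last first.
  rewrite mulr_ge0 ?invr_ge0 ?ler0n // sumr_ge0 // => i _; exact: omega_ge0.
rewrite mulr_natl -sumr_const mulr_sumr; apply: ler_sum => i.
rewrite inE => /existsP[x fx].
have Di : pdiff i (real_fun R f) != 0.
  apply: contraNneq fx => /eqP/pdiff_eq0P/(_ x (~~ x i)).
  by rewrite !ffunE -flipE => /eqP; rewrite eqr_nat; case: (f (flip x i)); case: (f x).
have k0 : (0 < k)%N.
  by case: k fk => // f0; rewrite (deg_le0_D i f0) eqxx in Di.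
rewrite -[k in leLHS]prednK // exprS ler_pM2l ?invr_gt0 ?ltr0n //.
by apply: omega_deg_le Di; apply: deg_le_D.
Qed.

Lemma weight_le_4416 f k : deg_le (real_fun R f) k -> weight (real_fun R f) <= 4416 / 1000.
Proof.
(* Degree bounds may be raised, so small degrees are covered by the estimate from 20 on. *)
move=> fk; pose m := maxn k 20.
have fm : deg_le (real_fun R f) m by apply: deg_le_leq fk; apply: leq_maxl.
have m20 : (20 <= m)%N by apply: leq_maxr.
apply: le_trans (weight_const_le R m20).
have m8 : (8 <= m)%N by apply: leq_trans m20.
apply: (weight_bound_const m8); first exact: fm.
exact: bs_le_bs_max m8 fm.
Qed.

End Juntas.

(** Reduction to natural numbers carries the bound from the field [R] over to [rat]. *)
Lemma ler_ratio_nat (K : realFieldType) (a b q e : nat) : (0 < q)%N ->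
  (a%:R <= b%:R / q%:R * e%:R :> K) = (a * q <= b * e)%N.
Proof. by move=> q0; rewrite mulrAC ler_pdivlMr ?ltr0n // -!natrM ler_nat. Qed.

Theorem theorem3 (R : realFieldType) (n : nat) (f : cube n -> bool)
  (c : {ffun {set 'I_n} -> R}) :
  (1 <= n)%N -> represents c f ->
  (#|relevant_set f|%:R : rat) <= (4416%:R / 1000%:R) * 2%:R ^+ (mdeg c).
Proof.
move=> _ /represents_deg_le fc.
have := le_trans (card_relevant_le_weight fc) (weight_le_4416 fc).
have p2 : 0 < 2 ^+ mdeg c :> R by rewrite exprn_gt0 ?ltr0n.
rewrite exprVn (ler_pdivrMr _ _ p2) -!natrX.
by rewrite !(@ler_ratio_nat _ _ _ 1000).
Qed.
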